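(* Let $d\ge 1$ and let $f\in\mathcal G(\mathbb R^d)$ be invariant under standard scaling, i.e. for every real $\lambda>0$ the equality $f(\lambda x)=f(x)$ holds in $\mathcal G(\mathbb R^d)$. Then $f$ is a generalized constant, i.e. there is $c\in\widetilde{\mathbb C}$ with $f=c$ in $\mathcal G(\mathbb R^d)$.
   Context: For $\Omega\subseteq\mathbb R^d$ open, the special Colombeau algebra is $\mathcal G(\Omega):=\mathcal E_M(\Omega)/\mathcal N(\Omega)$, where $\mathcal E_M(\Omega)$ is the set of nets $(u_\varepsilon)_{\varepsilon\in(0,1]}$ of (complex-valued) functions in $C^\infty(\Omega)$ such that for every compact $K\subset\Omega$ and every $\beta\in\mathbb N_0^d$ there is $N\ge 0$ with $\sup_{x\in K}|\partial^\beta u_\varepsilon(x)|=O(\varepsilon^{-N})$ as $\varepsilon\to 0$, and $\mathcal N(\Omega)$ is the set of nets such that for every compact $K\subset \Omega$, every $\beta\in\mathbb N_0^d$ and every $m\ge 0$, $\sup_{x\in K}|\partial^\beta u_\varepsilon(x)|=O(\varepsilon^{m})$ as $\varepsilon\to 0$. Operations are componentwise on representatives; $f(\lambda x)$ denotes the class of $(x\mapsto f_\varepsilon(\lambda x))_\varepsilon$. The ring of generalized numbers $\widetilde{\mathbb C}$ is the set of nets $(c_\varepsilon)_{\varepsilon\in(0,1]}$ in $\mathbb C$ with $|c_\varepsilon|=O(\varepsilon^{-N})$ for some $N$, modulo nets with $|c_\varepsilon|=O(\varepsilon^p)$ for all $p\ge0$. An element $c=[(c_\varepsilon)_\varepsilon]\in\widetilde{\mathbb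 C}$ is regarded as an element of $\mathcal G(\Omega)$ via the constant functions $c_\varepsilon$. *)

(* Defs.v *)
From HB Require Import structures.
From mathcomp Require Import all_boot all_order all_algebra.
From mathcomp Require Import generic_quotient ring_quotient complex.
From mathcomp Require Import all_classical all_reals all_analysis.
From mathcomp Require Import ring lra.

Set Implicit Arguments.
Unset Strict Implicit.
Unset Printing Implicit Defensive.

Import Order.TTheory GRing.Theory Num.Theory.
Import numFieldNormedType.Exports.

Local Open Scope classical_set_scope.
Local Open Scope ring_scope.
Local Open Scope quotient_scope.

Notation normc := ComplexField.Normc.normc.

Section Definitions.
Variables (R : realType) (d : nat).

Definition eps01 := {e : R | 0 < e <= 1}.

(* a_e = O(e ^ k) as e -> 0. No absolute value: a_e is always the modulus of a
   number or a supremum of moduli (which is -oo over the empty set). *)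
Definition eps_bigO (a : eps01 -> \bar R) (k : int) : Prop :=
  exists C : R, exists2 e0 : R, 0 < e0 &
    forall e : eps01, val e <= e0 -> (a e <= (C * val e ^ k)%:E)%E.

Definition partial (i : 'I_d) (g : 'rV[R]_d -> R) : 'rV[R]_d -> R :=
  fun x => 'D_(delta_mx 0 i) g x.

Definition partials (s : seq 'I_d) (g : 'rV[R]_d -> R) : 'rV[R]_d -> R :=
  foldr partial g s.

(* C^oo: iterated first partials, in any order, exist and are continuous. *)
Definition smooth (g : 'rV[R]_d -> R) : Prop :=
  forall s : seq 'I_d, continuous (partials s g) /\
    forall (i : 'I_d) (x : 'rV[R]_d), derivable (partials s g) x (delta_mx 0 i).

(* d_0^{b 0} d_1^{b 1} ... as an iterated partial derivative. *)
Definition multi_seq (b : {ffun 'I_d -> nat}) : seq 'I_d :=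
  flatten [seq nseq (b i) i | i <- enum 'I_d].

(* R[i] carries no normed module structure over R in the library: smoothness and
   derivatives are taken on real and imaginary parts. *)
Definition csmooth (u : 'rV[R]_d -> R[i]) : Prop :=
  smooth (fun x => complex.Re (u x)) /\ smooth (fun x => complex.Im (u x)).

Definition cpartials (s : seq 'I_d) (u : 'rV[R]_d -> R[i])
    (x : 'rV[R]_d) : R[i] :=
  (partials s (fun y => complex.Re (u y)) x +i*
   partials s (fun y => complex.Im (u y)) x)%C.

Definition sup_norm (K : set 'rV[R]_d) (u : 'rV[R]_d -> R[i]) : \bar R :=
  ereal_sup [set (normc (u x))%:E | x in K].

Definition moderate_net (u : eps01 -> 'rV[R]_d -> R[i]) : Prop :=
  (forall e, csmooth (u e)) /\
  forall (K : set 'rV[R]_d) (b : {ffun 'I_d -> nat}), compact K ->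
    exists N : nat, eps_bigO (fun e => sup_norm K (cpartials (multi_seq b) (u e))) (- N%:Z).

Definition negligible_net (u : eps01 -> 'rV[R]_d -> R[i]) : Prop :=
  (forall e, csmooth (u e)) /\
  forall (K : set 'rV[R]_d) (b : {ffun 'I_d -> nat}) (m : nat), compact K ->
    eps_bigO (fun e => sup_norm K (cpartials (multi_seq b) (u e))) m%:Z.

Definition moderate_num (c : eps01 -> R[i]) : Prop :=
  exists N : nat, eps_bigO (fun e => (normc (c e))%:E) (- N%:Z).

Definition negligible_num (c : eps01 -> R[i]) : Prop :=
  forall p : nat, eps_bigO (fun e => (normc (c e))%:E) p%:Z.

End Definitions.

Lemma eps01_one (R : realType) : 0 < (1 : R) <= 1.
Proof. by rewrite ltr01 lexx. Qed.

HB.instance Definition _ (R : realType) := Choice.on (eps01 R).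
HB.instance Definition _ (R : realType) :=
  isPointed.Build (eps01 R) (exist _ 1 (eps01_one R)).

Section Smooth.
Variables (R : realType) (d : nat).
Implicit Types (g h : 'rV[R]_d -> R) (s t : seq 'I_d).

Lemma partials_rcons s i g : partials (rcons s i) g = partials s (partial i g).
Proof. by rewrite /partials foldr_rcons. Qed.

Lemma smooth_partial i g : smooth g -> smooth (partial i g).
Proof. by move=> gs s; rewrite -partials_rcons; exact: gs. Qed.

Lemma smooth_derivable i g x : smooth g -> derivable g x (delta_mx 0 i).
Proof. by move=> /(_ [::]) [_]; apply. Qed.

Lemma partialD i g h : smooth g -> smooth h ->
  partial i (g \+ h) = partial i g \+ partial i h.
Proof.
move=> gs hs; apply/funext => x.
by rewrite /partial /= deriveD //; exact: smooth_derivable.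
Qed.

Lemma partialsD s g h : smooth g -> smooth h ->
  partials s (g \+ h) = partials s g \+ partials s h.
Proof.
elim/last_ind: s g h => [//|s i IH] g h gs hs.
rewrite !partials_rcons (partialD i gs hs).
by apply: IH; exact: smooth_partial.
Qed.

Lemma smoothD g h : smooth g -> smooth h -> smooth (g \+ h).
Proof.
move=> gs hs s; rewrite partialsD //; have [cg dg] := gs s.
have [ch dh] := hs s; split=> [x|i x]; first exact: cvgD (cg x) (ch x).
by apply: derivableD.
Qed.

Lemma partialN i g : smooth g -> partial i (\- g) = \- partial i g.
Proof.
move=> gs; apply/funext => x.
by rewrite /partial /= deriveN //; exact: smooth_derivable.
Qed.

Lemma partialsN s g : smooth g -> partials s (\- g) = \- partials s g.
Proof.
elim/last_ind: s g => [//|s i IH] g gs.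
rewrite !partials_rcons (partialN i gs).
by apply: IH; exact: smooth_partial.
Qed.

Lemma smoothN g : smooth g -> smooth (\- g).
Proof.
move=> gs s; rewrite partialsN //; have [cg dg] := gs s.
split=> [x|i x]; first exact: cvgN (cg x).
by apply: derivableN.
Qed.

Lemma partialM i g h : smooth g -> smooth h ->
  partial i (g \* h) = (g \* partial i h) \+ (partial i g \* h).
Proof.
move=> gs hs; apply/funext => x.
rewrite /partial /= deriveM; [|exact: smooth_derivable..].
by rewrite /GRing.scale /= [h x * _]mulrC.
Qed.


Inductive sum_prod : ('rV[R]_d -> R) -> Prop :=
| SumProdM g h of smooth g & smooth h : sum_prod (g \* h)
| SumProdD g h of sum_prod g & sum_prod h : sum_prod (g \+ h).

Lemma sum_prod_continuous g : sum_prod g -> continuous g.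
Proof.
elim=> [{}g h gs hs|{}g h _ cg _ ch] x.
  exact: cvgM ((gs [::]).1 x) ((hs [::]).1 x).
exact: cvgD (cg x) (ch x).
Qed.

Lemma sum_prod_derivable i x g : sum_prod g -> derivable g x (delta_mx 0 i).
Proof.
elim=> [{}g h gs hs|{}g h _ dg _ dh].
  by apply: derivableM; exact: smooth_derivable.
exact: derivableD.
Qed.

Lemma sum_prod_partial i g : sum_prod g -> sum_prod (partial i g).
Proof.
elim=> [{}g h gs hs|{}g h gs pg hs ph].
  rewrite (partialM i gs hs); have gi := smooth_partial i gs.
  have hi := smooth_partial i hs.
  by apply: SumProdD; [exact: (SumProdM gs hi)|exact: (SumProdM gi hs)].
suff -> : partial i (g \+ h) = partial i g \+ partial i h by exact: SumProdD.
apply/funext => x.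
by rewrite /partial /= deriveD //; exact: sum_prod_derivable.
Qed.

Lemma smoothM g h : smooth g -> smooth h -> smooth (g \* h).
Proof.
move=> gs hs s; have sp : sum_prod (partials s (g \* h)).
  by elim: s => [|i s IH] /=; [exact: SumProdM | exact: sum_prod_partial].
split=> [|i x]; first exact: sum_prod_continuous.
exact: sum_prod_derivable.
Qed.

Lemma partial_cst i (c : R) :
  partial i (cst c : 'rV[R]_d -> R) = cst 0.
Proof. by apply/funext => x; rewrite /partial derive_cst. Qed.

Lemma partials_cst s (c : R) : partials s (cst c : 'rV[R]_d -> R) =
  cst (if s is [::] then c else 0).
Proof.
elim: s => [//|i s IH] /=; rewrite IH; exact: partial_cst.
Qed.

Lemma smooth_cst (c : R) : smooth (cst c : 'rV[R]_d -> R).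
Proof.
move=> s; rewrite partials_cst; split=> [x|i x]; first exact: cst_continuous.
exact: derivable_cst.
Qed.

Lemma is_derive_line (g : 'rV[R]_d -> R) x v (a : R) :
  is_derive x v g a <-> is_derive (0 : R) 1 (fun t : R => g (t *: v + x)) a.
Proof.
have E : 'D_v g x = 'D_1 (fun t : R => g (t *: v + x)) 0.
  rewrite /derive; set g1 := fun y : R => y^-1 *: _; set g2 := fun y : R => y^-1 *: _.
  suff -> : g1 = g2 by [].
  by rewrite funeqE /g1 /g2 => y /=; rewrite addr0 scale0r add0r [_%:A]mulr1.
split=> -[dg <-].
  by split; [have /derivable1P := dg|rewrite E].
by split; [apply/derivable1P|rewrite E].
Qed.

Lemma is_derive_scale (l : R) i g x : smooth g ->
  is_derive x (delta_mx 0 i) (fun y => g (l *: y)) (l * partial i g (l *: x)).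
Proof.
move=> gs; apply/is_derive_line.
have dg : is_derive (l *: x) (delta_mx 0 i) g (partial i g (l *: x)).
  by apply: DeriveDef => //; exact: smooth_derivable.
move/is_derive_line in dg.
have dl : is_derive (0 : R) 1 (l \*: id) (l *: 1 : R) by exact: is_deriveZ.
rewrite -[0](_ : (l \*: id) 0 = 0) in dg; last by rewrite /= scaler0.
have := is_derive1_comp dg dl; rewrite /GRing.scale /= mulr1 mulrC.
suff -> : (fun t0 : R => g (l *: (t0 *: delta_mx 0 i + x))) =
  (fun t0 : R => g (t0 *: delta_mx 0 i + l *: x)) \o (l \*: id) by [].
by apply/funext => y /=; rewrite scalerDr scalerA.
Qed.

Lemma partial_scale (l : R) i g : smooth g ->
  partial i (fun x => g (l *: x)) = l \*: (fun x => partial i g (l *: x)).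
Proof.
move=> gs; apply/funext => x; rewrite /partial.
by have [_ ->] := is_derive_scale l i x gs.
Qed.

Lemma partials_scale (l : R) s g : smooth g ->
  partials s (fun x => g (l *: x)) =
  (fun x => l ^+ size s * partials s g (l *: x)).
Proof.
move=> gs; elim: s => [|i s IH] /=; first by apply/funext => x; rewrite mul1r.
have ps : smooth (partials s g) by move=> t; rewrite /partials -foldr_cat; exact: gs.
rewrite IH; apply/funext => x; rewrite /partial.
rewrite (_ : (fun y => _) = l ^+ size s \*: (fun y => partials s g (l *: y)))//.
have [dd E] := is_derive_scale l i x ps.
by rewrite (deriveZ _ dd) E [LHS]mulrA -exprSr.
Qed.

Lemma smooth_scale (l : R) g : smooth g -> smooth (fun x => g (l *: x)).
Proof.
move=> gs s; rewrite partials_scale //.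
have ps : smooth (partials s g) by move=> t; rewrite /partials -foldr_cat; exact: gs.
rewrite (_ : (fun y => _) = l ^+ size s \*: (fun y => partials s g (l *: y)))//.
split=> [x|i x].
  have cl : {for x, continuous (fun y : 'rV[R]_d => l *: y)}.
    exact: scaler_continuous.
  have cg : {for l *: x, continuous (partials s g)} by exact: (ps [::]).1.
  exact: cvgZr (continuous_comp cl cg).
by apply: derivableZ; have := is_derive_scale l i x ps; case.
Qed.

End Smooth.

Section ComplexSmooth.
Variables (R : realType) (d : nat).
Implicit Types (u v : 'rV[R]_d -> R[i]) (s t : seq 'I_d).

Let ReD (x y : R[i]) : complex.Re (x + y) = complex.Re x + complex.Re y.
Proof. by case: x; case: y. Qed.
Let ImD (x y : R[i]) : complex.Im (x + y) = complex.Im x + complex.Im y.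
Proof. by case: x; case: y. Qed.
Let ReN (x : R[i]) : complex.Re (- x) = - complex.Re x.
Proof. by case: x. Qed.
Let ImN (x : R[i]) : complex.Im (- x) = - complex.Im x.
Proof. by case: x. Qed.
Let ReM (x y : R[i]) : complex.Re (x * y) =
  complex.Re x * complex.Re y - complex.Im x * complex.Im y.
Proof. by case: x; case: y. Qed.
Let ImM (x y : R[i]) : complex.Im (x * y) =
  complex.Re x * complex.Im y + complex.Im x * complex.Re y.
Proof. by case: x; case: y. Qed.

Let cfE (T : Type) (f g : T -> R[i]) :
  (fun x => complex.Re (f x)) = (fun x => complex.Re (g x)) ->
  (fun x => complex.Im (f x)) = (fun x => complex.Im (g x)) -> f = g.
Proof.
move=> r i; apply/funext => x.
move: (congr1 (@^~ x) r) (congr1 (@^~ x) i) => /=.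
by case: (f x) (g x) => [a b] [a' b'] /= -> ->.
Qed.

Lemma csmoothD u v : csmooth u -> csmooth v -> csmooth (fun x => u x + v x).
Proof.
move=> [ru iu] [rv iv]; split.
  by under eq_fun do rewrite ReD; exact: (smoothD ru rv).
by under eq_fun do rewrite ImD; exact: (smoothD iu iv).
Qed.

Lemma csmoothN u : csmooth u -> csmooth (fun x => - u x).
Proof.
move=> [ru iu]; split.
  by under eq_fun do rewrite ReN; exact: (smoothN ru).
by under eq_fun do rewrite ImN; exact: (smoothN iu).
Qed.

Lemma csmoothM u v : csmooth u -> csmooth v -> csmooth (fun x => u x * v x).
Proof.
move=> [ru iu] [rv iv]; split.
  under eq_fun do rewrite ReM.
  exact: (smoothD (smoothM ru rv) (smoothN (smoothM iu iv))).
under eq_fun do rewrite ImM.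
exact: (smoothD (smoothM ru iv) (smoothM iu rv)).
Qed.

Lemma csmooth_cst (c : R[i]) : csmooth (cst c : 'rV[R]_d -> R[i]).
Proof. by split; exact: smooth_cst. Qed.

Lemma csmooth_scale (l : R) u : csmooth u -> csmooth (fun x => u (l *: x)).
Proof. by move=> [ru iu]; split; [exact: (smooth_scale l ru)|exact: (smooth_scale l iu)]. Qed.

Lemma csmooth_partial i u : csmooth u -> csmooth (cpartials [:: i] u).
Proof. by move=> [ru iu]; split; exact: smooth_partial. Qed.

Lemma cpartials_rcons s i u :
  cpartials (rcons s i) u = cpartials s (cpartials [:: i] u).
Proof. by apply/funext => x; rewrite /cpartials !partials_rcons. Qed.

Lemma cpartialsD s u v : csmooth u -> csmooth v ->
  cpartials s (fun x => u x + v x) =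
  (fun x => cpartials s u x + cpartials s v x).
Proof.
move=> [ru iu] [rv iv]; apply/funext => x; rewrite /cpartials.
under eq_fun do rewrite ReD.
under [in X in (_ +i* X)%C]eq_fun do rewrite ImD.
by rewrite (partialsD s ru rv) (partialsD s iu iv).
Qed.

Lemma cpartialsN s u : csmooth u ->
  cpartials s (fun x => - u x) = (fun x => - cpartials s u x).
Proof.
move=> [ru iu]; apply/funext => x; rewrite /cpartials.
under eq_fun do rewrite ReN.
under [in X in (_ +i* X)%C]eq_fun do rewrite ImN.
by rewrite (partialsN s ru) (partialsN s iu).
Qed.

Lemma cpartials_cst s (c : R[i]) :
  cpartials s (cst c : 'rV[R]_d -> R[i]) = cst (if s is [::] then c else 0).
Proof.
apply/funext => x; rewrite /cpartials !partials_cst /=.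
by case: s => //; case: c.
Qed.

Lemma cpartials_scale (l : R) s u : csmooth u ->
  cpartials s (fun x => u (l *: x)) =
  (fun x => (l ^+ size s)%:C%C * cpartials s u (l *: x)).
Proof.
move=> [ru iu]; apply/funext => x; rewrite /cpartials.
rewrite (partials_scale l s ru) (partials_scale l s iu).
by apply/eqP; rewrite eq_complex /= !mul0r subr0 addr0 !eqxx.
Qed.

Lemma cpartial1M i u v : csmooth u -> csmooth v ->
  cpartials [:: i] (fun x => u x * v x) =
  (fun x => u x * cpartials [:: i] v x + cpartials [:: i] u x * v x).
Proof.
move=> [ru iu] [rv iv].
have ruv := smoothM ru rv; have iuv := smoothM iu iv.
have riuv := smoothM ru iv; have iruv := smoothM iu rv.
apply/funext => x; rewrite /cpartials /=.
under eq_fun do rewrite ReM.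
under [in X in (_ +i* X)%C]eq_fun do rewrite ImM.
have E1 := congr1 (@^~ x) (partialD i ruv (smoothN iuv)).
have E2 := congr1 (@^~ x) (partialD i riuv iruv).
rewrite partialN // !partialM // in E1 E2.
rewrite [X in (X +i* _)%C]E1 [X in (_ +i* X)%C]E2 /=.
apply/eqP; rewrite eq_complex; apply/andP.
by rewrite ReD ImD !ReM !ImM /=; split; apply/eqP; ring.
Qed.

End ComplexSmooth.

Section Bounds.
Variable R : realType.
Local Notation E := (eps01 R).

Lemma eps_gt0 (e : E) : 0 < val e.
Proof. by case: e => e /= /andP[]. Qed.

Lemma eps_le1 (e : E) : val e <= 1.
Proof. by case: e => e /= /andP[]. Qed.

Lemma eps_le_exp (e : E) (k l : int) : l <= k -> val e ^ k <= val e ^ l.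
Proof.
move=> lk; rewrite -[k]opprK -[l]opprK -2!(exprz_inv (val e)).
rewrite ler_weXz2l ?lerN2 //.
by rewrite invf_ge1 ?eps_gt0 ?eps_le1.
Qed.

Definition bnd (T : Type) (K : set T) (a : E -> T -> R) (k : int) : Prop :=
  exists2 C : R, 0 <= C & exists2 e0 : R, 0 < e0 &
    forall e : E, val e <= e0 -> forall x, K x -> a e x <= C * val e ^ k.

Variables (T : Type) (K : set T).
Implicit Types (a b : E -> T -> R) (f g : E -> T -> R[i]) (k l : int).

Lemma bnd_le a b k :
  (forall e x, K x -> a e x <= b e x) -> bnd K b k -> bnd K a k.
Proof.
move=> ab [C C0 [e0 e00 H]]; exists C => //; exists e0 => // e ee0 x Kx.
exact: le_trans (ab _ _ Kx) (H _ ee0 _ Kx).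
Qed.

Lemma bnd_weak a k l : l <= k -> bnd K a k -> bnd K a l.
Proof.
move=> lk [C C0 [e0 e00 H]]; exists C => //; exists e0 => // e ee0 x Kx.
by rewrite (le_trans (H _ ee0 _ Kx)) // ler_wpM2l // eps_le_exp.
Qed.

Lemma bndD a b k : bnd K a k -> bnd K b k ->
  bnd K (fun e x => a e x + b e x) k.
Proof.
move=> [C C0 [e0 e00 H]] [D D0 [e1 e10 I]].
exists (C + D); first exact: addr_ge0.
exists (Num.min e0 e1); first by rewrite lt_min e00.
move=> e; rewrite le_min => /andP[ee0 ee1] x Kx.
by rewrite mulrDl lerD ?H ?I.
Qed.

Lemma bndM a b k l : (forall e x, 0 <= a e x) -> (forall e x, 0 <= b e x) ->
  bnd K a k -> bnd K b l -> bnd K (fun e x => a e x * b e x) (k + l).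
Proof.
move=> a0 b0 [C C0 [e0 e00 H]] [D D0 [e1 e10 I]].
exists (C * D); first exact: mulr_ge0.
exists (Num.min e0 e1); first by rewrite lt_min e00.
move=> e; rewrite le_min => /andP[ee0 ee1] x Kx.
rewrite exprzDr ?unitfE ?gt_eqF ?eps_gt0 // mulrACA.
by rewrite ler_pM ?H ?I.
Qed.

Lemma normc_ge0 (z : R[i]) : 0 <= normc z.
Proof. by case: z => x y; rewrite sqrtr_ge0. Qed.

Definition Mod f : Prop := exists N : nat, bnd K (fun e x => normc (f e x)) (- N%:Z).
Definition Neg f : Prop := forall m : nat, bnd K (fun e x => normc (f e x)) m%:Z.

Lemma ModD f g : Mod f -> Mod g -> Mod (fun e x => f e x + g e x).
Proof.
move=> [N Nf] [M Mg]; exists (maxn N M).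
apply: (@bnd_le _ (fun e x => normc (f e x) + normc (g e x))).
  by move=> e x _; exact: le_normcD.
by apply: bndD; [apply: bnd_weak Nf|apply: bnd_weak Mg];
  rewrite lerN2 lez_nat ?leq_maxl ?leq_maxr.
Qed.

Lemma ModM f g : Mod f -> Mod g -> Mod (fun e x => f e x * g e x).
Proof.
move=> [N Nf] [M Mg]; exists (N + M)%N; rewrite PoszD opprD.
apply: (@bnd_le _ (fun e x => normc (f e x) * normc (g e x))).
  by move=> e x _; rewrite ComplexField.Normc.normcM.
by apply: bndM => // *; exact: normc_ge0.
Qed.

Lemma ModN f : Mod f -> Mod (fun e x => - f e x).
Proof.
move=> [N Nf]; exists N; apply: bnd_le Nf => e x _.
by rewrite normcN.
Qed.

Lemma NegD f g : Neg f -> Neg g -> Neg (fun e x => f e x + g e x).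
Proof.
move=> Nf Ng m.
apply: (@bnd_le _ (fun e x => normc (f e x) + normc (g e x))).
  by move=> e x _; exact: le_normcD.
by apply: bndD.
Qed.

Lemma ModNegM f g : Mod f -> Neg g -> Neg (fun e x => f e x * g e x).
Proof.
move=> [N Nf] Ng m.
apply: (@bnd_le _ (fun e x => normc (f e x) * normc (g e x))).
  by move=> e x _; rewrite ComplexField.Normc.normcM.
have -> : m%:Z = - N%:Z + (N + m)%N%:Z by rewrite PoszD addKr.
by apply: bndM (Ng _) => // *; exact: normc_ge0.
Qed.

Lemma Mod_cst (c : R[i]) : Mod (fun _ _ => c).
Proof.
exists 0%N; exists (normc c); first exact: normc_ge0.
by exists 1 => // e _ x _; rewrite oppr0 expr0z mulr1.
Qed.

Lemma Neg0 : Neg (fun _ _ => 0).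
Proof.
move=> m; exists 0 => //; exists 1 => // e _ x _.
by rewrite ComplexField.Normc.normc0 mul0r.
Qed.

Lemma Neg1N x : K x -> ~ Neg (fun _ _ => 1).
Proof.
move=> Kx /(_ 1%N) [C C0 [e0 e00 H]].
pose r := Num.min (Num.min 1 e0) (2 * (C + 1))^-1.
have C1 : 0 < C + 1 by rewrite ltr_wpDl.
have r0 : 0 < r by rewrite !lt_min ltr01 e00 invr_gt0 mulr_gt0.
have r1 : r <= 1 by rewrite !ge_min lexx.
have rP : 0 < r <= 1 by rewrite r0.
have rC : r <= (2 * (C + 1))^-1 by rewrite ge_min lexx orbT.
have re : r <= e0 by rewrite !ge_min lexx orbT.
have : normc (1 : R[i]) <= C * r ^ 1 := H (exist _ r rP) re x Kx.
rewrite ComplexField.Normc.normc1 expr1z.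
apply/negP; rewrite -ltNge.
apply: (@le_lt_trans _ _ ((C + 1) * r)).
  by rewrite ler_wpM2r ?(ltW r0) // lerDl.
apply: (@le_lt_trans _ _ ((C + 1) * (2 * (C + 1))^-1)).
  by rewrite ler_pM2l.
by rewrite invfM mulrCA divff ?gt_eqF // mulr1; lra.
Qed.

Lemma bnd_sup f k :
  eps_bigO (fun e => ereal_sup [set (normc (f e x))%:E | x in K]) k <->
  bnd K (fun e x => normc (f e x)) k.
Proof.
split=> [[C [e0 e00 H]]|[C C0 [e0 e00 H]]].
  exists `|C| => //; exists e0 => // e ee0 x Kx.
  apply: (@le_trans _ _ (C * val e ^ k)); last first.
    by rewrite ler_wpM2r ?exprz_ge0 ?(ltW (eps_gt0 _)) // ler_norm.
  rewrite -lee_fin; apply: le_trans (H _ ee0).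
  by apply: ereal_sup_ubound; exists x.
exists C; exists e0 => // e ee0; apply: ge_ereal_sup => _ [x Kx <-].
by rewrite lee_fin H.
Qed.

End Bounds.

Section MultiSeq.
Variable d : nat.
Implicit Types (s t : seq 'I_d) (b : {ffun 'I_d -> nat}).

Lemma subseq_multi_seq t b :
  subseq t (multi_seq b) -> exists b', t = multi_seq b'.
Proof.
rewrite /multi_seq; have := enum_uniq 'I_d.
elim: (enum 'I_d) t => [|i l IH] t /=.
  by case: t => // _; exists b.
move=> /andP[il ul] /subseqP[m sm ->].
rewrite -(cat_take_drop (b i) m) mask_cat; last first.
  by rewrite size_takel ?size_nseq // sm size_cat size_nseq leq_addr.
have /(IH _ ul) [b' ->] : subseq (mask (drop (b i) m)
    (flatten [seq nseq (b j) j | j <- l])) (flatten [seq nseq (b j) j | j <- l]).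
  exact: mask_subseq.
have /all_pred1P E : all (pred1 i) (mask (take (b i) m) (nseq (b i) i)).
  apply/allP => j /mem_mask; rewrite mem_nseq /= => /andP[_ /eqP ->].
  exact: eqxx.
exists [ffun j => if j == i then size (mask (take (b i) m) (nseq (b i) i))
  else b' j].
rewrite ffunE eqxx -E; congr (_ ++ flatten _); apply/eq_in_map => j jl.
by rewrite ffunE; case: eqP => // ji; rewrite -ji jl in il.
Qed.

End MultiSeq.

Section Nets.
Variables (R : realType) (d : nat).
Local Notation E := (eps01 R).
Local Notation net := (E -> 'rV[R]_d -> R[i]).
Implicit Types (u v : net).

Definition smooth_net u := forall e, csmooth (u e).
Definition cpart (s : seq 'I_d) u : net := fun e => cpartials s (u e).

Lemma moderateE u : moderate_net u <-> smooth_net u /\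
  forall K b, compact K -> Mod K (cpart (multi_seq b) u).
Proof.
split=> -[su H]; split=> // K b cK; have [N HN] := H K b cK; exists N;
  exact/bnd_sup.
Qed.

Lemma negligibleE u : negligible_net u <-> smooth_net u /\
  forall K b, compact K -> Neg K (cpart (multi_seq b) u).
Proof.
split=> -[su H]; split=> // K b.
  by move=> cK m; have /bnd_sup := H K b m cK.
by move=> m cK; apply/bnd_sup; exact: H.
Qed.

Lemma leibniz (P Q S : net -> Prop) :
  (forall u v, P u -> Q v -> S (fun e x => u e x * v e x)) ->
  (forall u v, S u -> S v -> S (fun e x => u e x + v e x)) ->
  forall s u v, smooth_net u -> smooth_net v ->
  (forall t, subseq t s -> P (cpart t u)) ->
  (forall t, subseq t s -> Q (cpart t v)) ->
  S (cpart s (fun e x => u e x * v e x)).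
Proof.
move=> PQ SS; elim/last_ind => [|s i IH] u v su sv Pu Qv.
  have E0 w : cpart [::] w = w.
    by apply/funext => e; apply/funext => x; rewrite /cpart /cpartials /=;
       case: (w e x).
  by rewrite E0; apply: PQ; rewrite -[X in _ X]E0; auto.
have siu : smooth_net (cpart [:: i] u) by move=> e; exact: csmooth_partial.
have siv : smooth_net (cpart [:: i] v) by move=> e; exact: csmooth_partial.
have E1 t w : cpart t (cpart [:: i] w) = cpart (rcons t i) w.
  by apply/funext => e; rewrite /cpart cpartials_rcons.
have E2 : cpart (rcons s i) (fun e x => u e x * v e x) =
    (fun e x => cpart s (fun e x => u e x * cpart [:: i] v e x) e x +
                cpart s (fun e x => cpart [:: i] u e x * v e x) e x).
  apply/funext => e; rewrite /cpart cpartials_rcons cpartial1M //.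
  by rewrite cpartialsD //; apply: csmoothM => //; exact: csmooth_partial.
have sub1 t : subseq t s -> subseq t (rcons s i).
  by move=> ts; rewrite (subseq_trans ts) // subseq_rcons.
have sub2 t : subseq t s -> subseq (rcons t i) (rcons s i).
  by move=> ts; rewrite -!cats1 cat_subseq.
rewrite E2; apply: SS; apply: IH => // t ts.
- by apply: Pu; exact: sub1.
- by rewrite E1; apply: Qv; exact: sub2.
- by rewrite E1; apply: Pu; exact: sub2.
- by apply: Qv; exact: sub1.
Qed.

Lemma moderateD u v : moderate_net u -> moderate_net v ->
  moderate_net (fun e x => u e x + v e x).
Proof.
move=> /moderateE[su Mu] /moderateE[sv Mv]; apply/moderateE; split.
  by move=> e; exact: csmoothD.
move=> K b cK; rewrite [cpart _ _](_ : _ = fun e x =>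
  cpart (multi_seq b) u e x + cpart (multi_seq b) v e x).
  by apply: ModD; [exact: Mu|exact: Mv].
by apply/funext => e; rewrite /cpart cpartialsD.
Qed.

Lemma moderateN u : moderate_net u -> moderate_net (fun e x => - u e x).
Proof.
move=> /moderateE[su Mu]; apply/moderateE; split.
  by move=> e; exact: csmoothN.
move=> K b cK; rewrite [cpart _ _](_ : _ = fun e x =>
  - cpart (multi_seq b) u e x); first by apply: ModN; exact: Mu.
by apply/funext => e; rewrite /cpart cpartialsN.
Qed.

Lemma moderateM u v : moderate_net u -> moderate_net v ->
  moderate_net (fun e x => u e x * v e x).
Proof.
move=> /moderateE[su Mu] /moderateE[sv Mv]; apply/moderateE; split.
  by move=> e; exact: csmoothM.
move=> K b cK; apply: (@leibniz (Mod K) (Mod K) (Mod K)) => //.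
- exact: ModM.
- exact: ModD.
- by move=> t /subseq_multi_seq [b' ->]; exact: Mu.
- by move=> t /subseq_multi_seq [b' ->]; exact: Mv.
Qed.

Lemma moderate_cst (c : R[i]) : moderate_net (fun (_ : E) (_ : 'rV[R]_d) => c).
Proof.
apply/moderateE; split; first by move=> e; exact: csmooth_cst.
move=> K b _; rewrite /cpart cpartials_cst; exact: Mod_cst.
Qed.

Lemma moderate_scale (l : R) u : moderate_net u -> moderate_net (fun e x => u e (l *: x)).
Proof.
move=> /moderateE[su Mu]; apply/moderateE; split.
  by move=> e; exact: csmooth_scale.
move=> K b cK; set s := multi_seq b.
rewrite [cpart _ _](_ : _ = fun e x =>
  (l ^+ size s)%:C%C * cpart s u e (l *: x)); last first.
  by apply/funext => e; rewrite /cpart cpartials_scale.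
apply: ModM; first exact: Mod_cst.
have [N [C C0 [e0 e00 H]]] : Mod ( *:%R l @` K) (cpart s u).
  apply: Mu; apply: continuous_compact => //.
  by apply: continuous_subspaceT => x; exact: scaler_continuous.
exists N; exists C => //; exists e0 => // e ee0 x Kx; by apply: H => //; exists x.
Qed.

Lemma negligibleD u v : negligible_net u -> negligible_net v ->
  negligible_net (fun e x => u e x + v e x).
Proof.
move=> /negligibleE[su Mu] /negligibleE[sv Mv]; apply/negligibleE; split.
  by move=> e; exact: csmoothD.
move=> K b cK; rewrite [cpart _ _](_ : _ = fun e x =>
  cpart (multi_seq b) u e x + cpart (multi_seq b) v e x).
  by apply: NegD; [exact: Mu|exact: Mv].
by apply/funext => e; rewrite /cpart cpartialsD.
Qed.

Lemma negligible0 : negligible_net (fun (_ : E) (_ : 'rV[R]_d) => 0).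
Proof.
apply/negligibleE; split; first by move=> e; exact: csmooth_cst.
move=> K b _; rewrite /cpart cpartials_cst.
by rewrite (_ : (if _ is [::] then 0 else 0) = 0); [exact: Neg0|case: multi_seq].
Qed.

Lemma negligibleM u v : moderate_net u -> negligible_net v ->
  negligible_net (fun e x => u e x * v e x).
Proof.
move=> /moderateE[su Mu] /negligibleE[sv Mv]; apply/negligibleE; split.
  by move=> e; exact: csmoothM.
move=> K b cK; apply: (@leibniz (Mod K) (Neg K) (Neg K)) => //.
- exact: ModNegM.
- exact: NegD.
- by move=> t /subseq_multi_seq [b' ->]; exact: Mu.
- by move=> t /subseq_multi_seq [b' ->]; exact: Mv.
Qed.

Lemma negligible1N : ~ negligible_net (fun (_ : E) (_ : 'rV[R]_d) => 1).
Proof.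
move=> /negligibleE[_ /(_ [set 0] [ffun=> 0%N] (@compact_set1 _ _))].
rewrite /cpart cpartials_cst (_ : multi_seq _ = [::]); first exact: Neg1N.
by rewrite /multi_seq; elim: (enum _) => //= i l ->; rewrite ffunE.
Qed.

Lemma negligible_scale (l : R) u :
  negligible_net u -> negligible_net (fun e x => u e (l *: x)).
Proof.
move=> /negligibleE[su Mu]; apply/negligibleE; split.
  by move=> e; exact: csmooth_scale.
move=> K b cK; set s := multi_seq b.
rewrite [cpart _ _](_ : _ = fun e x =>
  (l ^+ size s)%:C%C * cpart s u e (l *: x)); last first.
  by apply/funext => e; rewrite /cpart cpartials_scale.
apply: ModNegM; first exact: Mod_cst.
have H : Neg ( *:%R l @` K) (cpart s u).
  apply: Mu; apply: continuous_compact => //.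
  by apply: continuous_subspaceT => x; exact: scaler_continuous.
move=> m; have [C C0 [e0 e00 {}H]] := H m.
exists C => //; exists e0 => // e ee0 x Kx; by apply: H => //; exists x.
Qed.

End Nets.

Section Colombeau.
Variables (R : realType) (d : nat).
Local Notation net := (eps01 R -> 'rV[R]_d -> R[i]).

Definition moderate_pred : {pred net} := fun u => `[< moderate_net u >].

Lemma moderate_subring : subring_closed moderate_pred.
Proof.
split=> [|u v /asboolP mu /asboolP mv|u v /asboolP mu /asboolP mv];
  apply/asboolP; first exact: moderate_cst.
- exact: moderateD mu (moderateN mv).
- exact: moderateM.
Qed.

HB.instance Definition _ :=
  GRing.isSubringClosed.Build net moderate_pred moderate_subring.

(* EM is the ring of moderate nets of smooth functions on R^d, N_pred the ideal
   of negligible nets, colombeau the quotient ring G(R^d). *)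
Record EM := MkEM { EM_val :> net; _ : EM_val \in moderate_pred }.

HB.instance Definition _ := [isSub for EM_val].
HB.instance Definition _ := [Choice of EM by <:].
HB.instance Definition _ := [SubChoice_isSubComNzRing of EM by <:].

Lemma EMP (u : EM) : moderate_net u.
Proof. by case: u => u mu; exact/asboolP. Qed.

Definition EM_of u (mu : moderate_net u) : EM := @MkEM u (asboolT mu).

Definition N_pred : {pred EM} := fun u => `[< negligible_net u >].

Lemma N_ideal : idealr_closed N_pred.
Proof.
split=> [||a u v /asboolP nu /asboolP nv].
- by apply/asboolP; exact: negligible0.
- apply/asboolP; rewrite [EM_val _](_ : _ = fun _ _ => 1); last by [].
  exact: negligible1N.
- apply/asboolP; rewrite [EM_val _](_ : _ =
    fun e x => EM_val a e x * EM_val u e x + EM_val v e x); last by [].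
  have ma := EMP a.
  exact: (negligibleD (negligibleM ma nu) nv).
Qed.

HB.instance Definition _ := isIdealr.Build EM N_pred N_ideal.

Definition colombeau := {ideal_quot N_pred}.

End Colombeau.

Section Numbers.
Variable R : realType.
Local Notation net := (eps01 R -> R[i]).

Let MP (c : net) : moderate_num c <-> Mod [set: unit] (fun e _ => c e).
Proof.
split=> -[N].
  move=> [C [e0 e00 H]]; exists N; exists `|C| => //; exists e0 => // e ee0 x _.
  apply: (@le_trans _ _ (C * val e ^ (- N%:Z))); first by rewrite -lee_fin H.
  by rewrite ler_wpM2r ?exprz_ge0 ?(ltW (eps_gt0 _)) // ler_norm.
move=> [C C0 [e0 e00 H]]; exists N; exists C; exists e0 => // e ee0.
by rewrite lee_fin (H e ee0 tt).
Qed.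

Let NP (c : net) : negligible_num c <-> Neg [set: unit] (fun e _ => c e).
Proof.
split=> H m; have := H m.
  move=> [C [e0 e00 {}H]]; exists `|C| => //; exists e0 => // e ee0 x _.
  apply: (@le_trans _ _ (C * val e ^ m%:Z)); first by rewrite -lee_fin H.
  by rewrite ler_wpM2r ?exprz_ge0 ?(ltW (eps_gt0 _)) // ler_norm.
move=> [C C0 [e0 e00 {}H]]; exists C; exists e0 => // e ee0.
by rewrite lee_fin (H e ee0 tt).
Qed.

Definition moderate_num_pred : {pred net} := fun c => `[< moderate_num c >].

Lemma moderate_num_subring : subring_closed moderate_num_pred.
Proof.
split=> [|u v /asboolP/MP mu /asboolP/MP mv|u v /asboolP/MP mu /asboolP/MP mv];
  apply/asboolP/MP; first exact: Mod_cst.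
- exact: (ModD mu (ModN mv)).
- exact: (ModM mu mv).
Qed.

HB.instance Definition _ :=
  GRing.isSubringClosed.Build net moderate_num_pred moderate_num_subring.

Record EMnum := MkEMnum { EMnum_val :> net; _ : EMnum_val \in moderate_num_pred }.

HB.instance Definition _ := [isSub for EMnum_val].
HB.instance Definition _ := [Choice of EMnum by <:].
HB.instance Definition _ := [SubChoice_isSubComNzRing of EMnum by <:].

Lemma EMnumP (c : EMnum) : moderate_num c.
Proof. by case: c => c mc; exact/asboolP. Qed.

Definition Nnum_pred : {pred EMnum} := fun c => `[< negligible_num c >].

Lemma Nnum_ideal : idealr_closed Nnum_pred.
Proof.
split=> [||a u v /asboolP/NP nu /asboolP/NP nv].
- by apply/asboolP/NP; exact: Neg0.
- apply/asboolP/NP; rewrite [EMnum_val _](_ : _ = fun _ => 1); last by [].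
  exact: (@Neg1N _ _ _ tt).
- apply/asboolP/NP; rewrite [EMnum_val _](_ : _ =
    fun e => EMnum_val a e * EMnum_val u e + EMnum_val v e); last by [].
  by have /MP ma := EMnumP a; exact: (NegD (ModNegM ma nu) nv).
Qed.

HB.instance Definition _ := isIdealr.Build EMnum Nnum_pred Nnum_ideal.

(* The ring of generalized complex numbers. *)
Definition gen_complex := {ideal_quot Nnum_pred}.

End Numbers.

Section Operations.
Variables (R : realType) (d : nat).
Implicit Types (u v : EM R d) (c : EMnum R).

Lemma pi_colombeau_eq u v :
  \pi_(colombeau R d) u = \pi_(colombeau R d) v <->
  negligible_net (fun e x => EM_val u e x - EM_val v e x).
Proof.
split=> [/eqP|H].
  by rewrite -Quotient.idealrBE => /asboolP.
by apply/eqP; rewrite -Quotient.idealrBE; apply/asboolP.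
Qed.

Lemma pi_gen_complex_eq (c c' : EMnum R) :
  \pi_(gen_complex R) c = \pi_(gen_complex R) c' <->
  negligible_num (fun e => EMnum_val c e - EMnum_val c' e).
Proof.
split=> [/eqP|H].
  by rewrite -Quotient.idealrBE => /asboolP.
by apply/eqP; rewrite -Quotient.idealrBE; apply/asboolP.
Qed.

(* Class of (x |-> f_e (l x))_e; independent of representatives, see pi_dilate. *)
Definition EM_dilate (l : R) u : EM R d := EM_of (moderate_scale l (EMP u)).

Definition dilate (l : R) (f : colombeau R d) : colombeau R d :=
  \pi_(colombeau R d) (EM_dilate l (repr f)).

Lemma pi_dilate l u : dilate l (\pi_(colombeau R d) u) =
  \pi_(colombeau R d) (EM_dilate l u).
Proof.
apply/pi_colombeau_eq; apply: (negligible_scale l (u := fun e x =>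
  EM_val (repr (\pi_(colombeau R d) u)) e x - EM_val u e x)).
by apply/pi_colombeau_eq; rewrite reprK.
Qed.

Lemma eps_bigO_csts (c : eps01 R -> R[i]) (K : set 'rV[R]_d) (k : int) :
  eps_bigO (fun e => (normc (c e))%:E) k -> bnd K (fun e _ => normc (c e)) k.
Proof.
move=> [C [e0 e00 H]]; exists `|C| => //; exists e0 => // e ee0 x _.
apply: (@le_trans _ _ (C * val e ^ k)); first by rewrite -lee_fin H.
by rewrite ler_wpM2r ?exprz_ge0 ?(ltW (eps_gt0 _)) // ler_norm.
Qed.

Lemma cpart_csts (s : seq 'I_d) (c : eps01 R -> R[i]) :
  cpart s (fun e (_ : 'rV[R]_d) => c e) =
  if s is [::] then fun e _ => c e else fun _ _ => 0.
Proof. by apply/funext => e; rewrite /cpart cpartials_cst; case: s. Qed.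

Lemma moderate_csts (c : eps01 R -> R[i]) : moderate_num c ->
  moderate_net (fun e (_ : 'rV[R]_d) => c e).
Proof.
move=> [N HN]; apply/moderateE; split; first by move=> e; exact: csmooth_cst.
move=> K b _; rewrite cpart_csts; case: multi_seq => [|i s].
  by exists N; exact: eps_bigO_csts.
exact: Mod_cst.
Qed.

Lemma negligible_csts (c : eps01 R -> R[i]) : negligible_num c ->
  negligible_net (fun e (_ : 'rV[R]_d) => c e).
Proof.
move=> Nc; apply/negligibleE; split; first by move=> e; exact: csmooth_cst.
move=> K b _; rewrite cpart_csts; case: multi_seq => [|i s].
  by move=> m; exact: eps_bigO_csts.
exact: Neg0.
Qed.

(* The embedding of generalized numbers as constant functions; independent of
   representatives, see pi_gconst. *)
Definition EM_const c : EM R d := EM_of (moderate_csts (EMnumP c)).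

Definition gconst (c : gen_complex R) : colombeau R d :=
  \pi_(colombeau R d) (EM_const (repr c)).

Lemma pi_gconst c :
  gconst (\pi_(gen_complex R) c) = \pi_(colombeau R d) (EM_const c).
Proof.
apply/pi_colombeau_eq.
apply: (negligible_csts (c := fun e =>
  EMnum_val (repr (\pi_(gen_complex R) c)) e - EMnum_val c e)).
by apply/pi_gen_complex_eq; rewrite reprK.
Qed.

End Operations.

Arguments gconst {R} d c.

(* Main.v *)
Require Import Defs.
From mathcomp Require Import all_boot all_order all_algebra.
From mathcomp Require Import all_classical all_reals.
From mathcomp Require Import all_analysis generic_quotient complex.
From mathcomp Require Import ring lra.

Import Order.TTheory GRing.Theory Num.Theory.
Import numFieldNormedType.Exports.
Local Open Scope ring_scope.
Local Open Scope classical_set_scope.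
Local Open Scope quotient_scope.

(** Invariance under the single dilation [x |-> x / 2] already suffices. On a
    cube [K] centred at the origin, [K / 2] is contained in [K]; if [v] is a
    derivative of [u_e] of order [k >= 1] then [v x = 2^-k v (x / 2) + O(e^m)]
    on [K], so [sup_K |v| <= sup_K |v| / 2 + O(e^m)] and, the supremum being
    finite, [sup_K |v| = O(e^m)]. Integrating the first partials along the edges
    of a box from [0] to [x] gives [u_e x - u_e 0 = O(e^m)], so [f] is the class
    of the net of constants [u_e 0]. *)

(** * Comparison of the complex modulus with real and imaginary parts *)

Section Complex.
Variable R : realType.
Implicit Types z w : R[i].

Lemma Re_sub z w : complex.Re (z - w) = complex.Re z - complex.Re w.
Proof. by case: z; case: w. Qed.

Lemma Im_sub z w : complex.Im (z - w) = complex.Im z - complex.Im w.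
Proof. by case: z; case: w. Qed.

Lemma Re_le_normc z : `|complex.Re z| <= normc z.
Proof. by case: z => a b; rewrite /= -sqrtr_sqr ler_wsqrtr // lerDl sqr_ge0. Qed.

Lemma Im_le_normc z : `|complex.Im z| <= normc z.
Proof. by case: z => a b; rewrite /= -sqrtr_sqr ler_wsqrtr // lerDr sqr_ge0. Qed.

Lemma normc_real (a : R) : normc a%:C%C = `|a|.
Proof. by rewrite /= expr0n addr0 sqrtr_sqr. Qed.

Lemma normc_le_ReIm z : normc z <= `|complex.Re z| + `|complex.Im z|.
Proof.
case: z => a b /=.
rewrite -[leRHS]ger0_norm ?addr_ge0 // -sqrtr_sqr ler_wsqrtr //.
rewrite sqrrD !real_normK ?num_real //.
by rewrite lerD2r lerDl mulrn_wge0 // mulr_ge0.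
Qed.

End Complex.

(** * Mean value estimates on cubes centred at the origin *)

Section Cube.
Variables (R : realType) (d : nat).
Implicit Types (r : R) (x y : 'rV[R]_d) (i : 'I_d) (g : 'rV[R]_d -> R).

(** Cubes exhaust the compact sets, are stable under halving, and contain, along with [x], the path
    from 0 to [x] that changes one coordinate at a time. *)
Definition cube r : set 'rV[R]_d := [set x | forall i, `|x 0 i| <= r].

Lemma compact_cube r : compact (cube r).
Proof.
have -> : cube r = [set x : 'rV[R]_d | forall i, `[- r, r] (x 0 i)].
  by apply/seteqP; split => x xr i; have := xr i; rewrite /= in_itv /= ler_norml.
by apply: (@rV_compact _ _ (fun=> `[- r, r])) => i; exact: segment_compact.
Qed.

Lemma compact_sub_cube (K : set 'rV[R]_d) :
  compact K -> exists r, K `<=` cube r.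
Proof.
move=> /compact_bounded [M [_ KM]].
(* [compact_bounded] bounds the norm on [K] by every real strictly above [M]. *)
exists (`|M| + 1) => x Kx i.
have Mr : M < `|M| + 1 by rewrite ltr_pwDr // ler_norm.
apply: le_trans (KM _ Mr _ Kx).
rewrite [leRHS]/Num.norm /= mx_normrE.
exact: (le_bigmax _ (fun ij : 'I_1 * 'I_d => `|x ij.1 ij.2|) (0, i)).
Qed.

Lemma cube_half r x : cube r x -> cube r (2^-1 *: x).
Proof.
move=> xr i; rewrite mxE normrM ger0_norm ?invr_ge0 //.
by have := xr i; have := normr_ge0 (x 0 i); lra.
Qed.

(** Running over the segment with a parameter in [0, 1] avoids a case distinction on the sign of
    [t]. *)
Lemma is_derive_segment g i (t s : R) y : smooth g ->
  is_derive s (1 : R) (fun z : R => g ((z * t) *: delta_mx 0 i + y))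
    (t * partial i g ((s * t) *: delta_mx 0 i + y)).
Proof.
move=> gs; set p := (s * t) *: delta_mx 0 i + y.
have dg : is_derive p (delta_mx 0 i) g (partial i g p).
  by apply: DeriveDef => //; exact: smooth_derivable.
move/is_derive_line in dg.
(* [is_derive_line] differentiates at parameter 0, so the inner affine map is chosen to vanish at
   [s]. *)
have dl : is_derive s (1 : R) (fun z : R => t * (z - s)) (t * 1).
  apply: (@is_deriveZ R _ _ (fun z : R => z - s) t).
  by rewrite -[X in is_derive _ _ _ X]subr0; apply: is_deriveB.
rewrite -[0](_ : (fun z : R => t * (z - s)) s = 0) in dg;
  last by rewrite subrr mulr0.
have := @is_derive1_comp R _ (fun z : R => t * (z - s)) _ _ _ dg dl.
rewrite mulr1 mulrC.
rewrite (_ : _ \o _ = fun z : R => g ((z * t) *: delta_mx 0 i + y)) //.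
apply/funext => z /=; congr g.
rewrite /p addrA -scalerDl; congr (_ *: _ + _); ring.
Qed.

Lemma mean_value_coord g i (M t : R) y : smooth g ->
  (forall s : R, 0 <= s <= 1 ->
     `|partial i g ((s * t) *: delta_mx 0 i + y)| <= M) ->
  `|g (t *: delta_mx 0 i + y) - g y| <= M * `|t|.
Proof.
move=> gs gM.
have dh s := is_derive_segment g i t s y gs.
have ch : continuous (fun z : R => g ((z * t) *: delta_mx 0 i + y)).
  move=> s; apply: differentiable_continuous; apply/derivable1_diffP.
  by have [] := dh s.
have [s sI] := @MVT_segment R _ _ 0 1 ler01 (fun s _ => dh s)
  (continuous_subspaceT ch).
rewrite mul1r mul0r scale0r add0r subr0 mulr1 => ->.
by rewrite normrM mulrC ler_wpM2r // gM //; move: sI; rewrite in_itv.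
Qed.

Lemma mean_value_cube g (M r : R) : smooth g ->
  (forall i x, cube r x -> `|partial i g x| <= M) ->
  forall x, cube r x -> `|g x - g 0| <= (M * r) *+ d.
Proof.
move=> gs gM x xr.
(* The corners of the edge path: [p 0] is the origin, [p d] is [x], and consecutive corners differ
   in one coordinate. *)
pose p k : 'rV[R]_d := \row_j (if (j < k)%N then x 0 j else 0).
have p0 : p 0%N = 0 by apply/rowP => j; rewrite !mxE.
have pd : p d = x by apply/rowP => j; rewrite !mxE ltn_ord.
have pS (k : 'I_d) : p k.+1 = x 0 k *: delta_mx 0 k + p k.
  apply/rowP => j; rewrite !mxE eqxx /= ltnS leq_eqVlt -val_eqE /=.
  by case: ltngtP => [_|_|/val_inj ->]; rewrite ?mulr0 ?mulr1 ?add0r ?addr0.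
have step (k : 'I_d) : `|g (p k.+1) - g (p k)| <= M * r.
  have M0 : 0 <= M.
    by apply: le_trans (gM k x xr); exact: normr_ge0.
  rewrite pS; apply: le_trans (ler_wpM2l M0 (xr k)).
  (* The edge stays in the cube: coordinate [k] is [s * x 0 k] with [s] in [0, 1], any other is 0 or
     that of [x]. *)
  apply: mean_value_coord => // s /andP[s0 s1]; apply: gM => j.
  have r0 : 0 <= r by apply: le_trans (xr k).
  rewrite !mxE eqxx /=; have [->|_] := eqVneq j k; last first.
    by rewrite mulr0 add0r; case: ifP; rewrite ?normr0.
  rewrite ltnn mulr1 addr0 normrM ger0_norm //; apply: le_trans (xr k).
  by rewrite ler_piMl.
suff H k : (k <= d)%N -> `|g (p k) - g 0| <= (M * r) *+ k.
  by rewrite -[in g x]pd H.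
elim: k => [_|k IH kd]; first by rewrite p0 subrr normr0.
rewrite -(subrKA (g (p k))) mulrS (le_trans (ler_normD _ _)) //.
by rewrite lerD ?IH ?(ltnW kd) //; exact: (step (Ordinal kd)).
Qed.

(** The mean value theorem is real-valued; treating real and imaginary parts separately costs the
    factor 2. *)
Lemma cmean_value_cube (u : 'rV[R]_d -> R[i]) (M r : R) : csmooth u ->
  (forall i x, cube r x -> normc (cpartials [:: i] u x) <= M) ->
  forall x, cube r x -> normc (u x - u 0) <= (M * r) *+ d *+ 2.
Proof.
move=> [ru iu] uM x xr; apply: le_trans (normc_le_ReIm _ _) _.
rewrite Re_sub Im_sub mulr2n lerD //.
  apply: (mean_value_cube _ M r ru) xr => i y yr.
  exact: le_trans (Re_le_normc _ (cpartials [:: i] u y)) (uM i y yr).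
apply: (mean_value_cube _ M r iu) xr => i y yr.
exact: le_trans (Im_le_normc _ (cpartials [:: i] u y)) (uM i y yr).
Qed.

End Cube.

Arguments cube {R d} r.

(** The bound [B], whatever its size, makes the supremum S of [a] over [K] finite, so S <= c + S/2
    can be solved for S. *)
Lemma sup_absorb {R : realType} {T : Type} (K : set T) (a : T -> R) (h : T -> T)
    (B c : R) :
  (forall x, K x -> a x <= B) -> (forall x, K x -> K (h x)) ->
  (forall x, K x -> a x <= c + 2^-1 * a (h x)) ->
  forall x, K x -> a x <= 2 * c.
Proof.
move=> aB Kh ah x Kx.
have hs : has_sup (a @` K).
  by split; [exists (a x), x|exists B => _ [y Ky <-]; exact: aB].
have le_sup y : K y -> a y <= sup (a @` K).
  by move=> Ky; apply: sup_upper_bound => //; exists y.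
have : sup (a @` K) <= c + 2^-1 * sup (a @` K).
  apply: ge_sup; first by exists (a x), x.
  move=> _ [y Ky <-]; have := ah _ Ky; have := le_sup _ (Kh _ Ky); lra.
by have := le_sup _ Kx; lra.
Qed.

Lemma bnd_sum {R : realType} {T I : Type} (K : set T)
    (a : I -> eps01 R -> T -> R) (k : int) (l : seq I) :
  (forall i, bnd K (a i) k) -> bnd K (fun e x => \sum_(i <- l) a i e x) k.
Proof.
move=> ak; elim: l => [|i l IH].
  exists 0 => //; exists 1 => // e _ x _; rewrite big_nil mul0r //.
by apply: bnd_le (bndD (ak i) IH) => e x _; rewrite big_cons.
Qed.

(** * Nets invariant under halving up to a negligible net *)

Section HalfInvariant.
Variables (R : realType) (d : nat) (u : eps01 R -> 'rV[R]_d -> R[i]).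
Hypotheses (mu : moderate_net u)
  (nu : negligible_net (fun e x => u e (2^-1 *: x) - u e x)).

Lemma negligible_partials (r : R) b : multi_seq b != [::] ->
  Neg (cube r) (cpart (multi_seq b) u).
Proof.
move=> b0 m; have /moderateE[su /(_ _ b (compact_cube R d r))[N Mu]] := mu.
have /negligibleE[_ /(_ _ b (compact_cube R d r) m) Nu] := nu.
case: Mu => B _ [e0 e00 Mu]; case: Nu => C C0 [e1 e10 Nu].
set s := multi_seq b in b0 Mu Nu *.
exists (2 * C); first exact: mulr_ge0.
exists (Num.min e0 e1) => [|e]; first by rewrite lt_min e00.
rewrite le_min => /andP[ee0 ee1] x xr; rewrite -mulrA.
(* Moderateness provides the finite bound for this fixed [e]; its exponent [N] does not enter the
   result. *)
apply: (sup_absorb _ (fun x => normc (cpart s u e x)) _ _ _ (Mu e ee0)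
  (cube_half R d r)) xr.
move=> {}x xr; have := Nu e ee1 x xr; rewrite /cpart.
have suh : csmooth (fun y => u e (2^-1 *: y)) by exact: csmooth_scale.
rewrite (cpartialsD s suh (csmoothN (su e))) cpartialsN // cpartials_scale //.
cbv beta.
set v := cpartials s (u e) x; set w := cpartials s (u e) (2^-1 *: x).
set a := 2^-1 ^+ size s => H.
have ha : normc (a%:C%C * w) <= 2^-1 * normc w.
  rewrite ComplexField.Normc.normcM normc_real ler_wpM2r ?normc_ge0 //.
  (* As [s] is nonempty, one factor 1/2 splits off and the remaining power is at most 1. *)
  rewrite /a; case: (s) b0 => // i t _ /=.
  rewrite ger0_norm ?exprn_ge0 ?invr_ge0 // exprS ler_piMr ?invr_ge0 //.
  by rewrite exprn_ile1 ?invr_ge0 ?invf_le1 ?ler1n.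
have -> : v = - (a%:C%C * w - v) + a%:C%C * w by ring.
by apply: le_trans (le_normcD _ _) _; rewrite normcN lerD.
Qed.

(** At order zero halving gives no contraction factor, so the estimate is integrated from the first
    partials. *)
Lemma negligible_sub_origin (r : R) :
  Neg (cube r) (fun e x => u e x - u e 0).
Proof.
move=> m; have [su _] := mu.
(* The sum yields one constant and one threshold for all directions at once. *)
pose S (e : eps01 R) x := \sum_(i < d) normc (cpart [:: i] u e x).
have [C C0 [e0 e00 H]] : bnd (cube r) S m.
  apply: bnd_sum => i.
  (* A single direction is a subsequence of the multi-index (1, ..., 1), hence itself comes from a
     multi-index. *)
  have [|b bi] := @subseq_multi_seq d [:: i] [ffun=> 1%N].
    rewrite sub1seq; apply/flattenP; exists [:: i]; last by rewrite mem_seq1.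
    by apply/mapP; exists i; rewrite ?mem_enum // ffunE.
  by rewrite bi; apply: negligible_partials; rewrite -bi.
(* The absolute value keeps the constant nonnegative when [r] is negative. *)
exists ((C * `|r|) *+ d *+ 2); first by rewrite !mulrn_wge0 // mulr_ge0.
exists e0 => // e ee0 x xr.
have CE : 0 <= C * val e ^ m by rewrite mulr_ge0 // exprz_ge0 // ltW // eps_gt0.
have Si i y : normc (cpartials [:: i] (u e) y) <= S e y.
  by rewrite /S (bigD1 i) //= lerDl sumr_ge0 // => j _; exact: normc_ge0.
apply: le_trans (cmean_value_cube R d (u e) (C * val e ^ m) r (su e) _ x xr) _.
  by move=> i y yr; apply: le_trans (Si i y) (H _ ee0 _ yr).
rewrite !mulrnAl [C * `|r| * _]mulrAC !lerMn2r.
by rewrite (ler_wpM2l CE (ler_norm r)) !orbT.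
Qed.

End HalfInvariant.

Theorem theorem3p4 (R : realType) (d : nat) (hd : (1 <= d)%N)
  (f : colombeau R d)
  (hf : forall lambda : R, 0 < lambda -> dilate lambda f = f) :
  exists c : gen_complex R, f = gconst d c.
Proof.
set u := repr f; have fu : f = \pi_(colombeau R d) u by rewrite reprK.
have mu : moderate_net u := EMP u.
have nu : negligible_net (fun e x => u e (2^-1 *: x) - u e x).
  have := hf 2^-1; rewrite invr_gt0 ltr0n => /(_ isT).
  by rewrite fu pi_dilate => /pi_colombeau_eq.
(* Moderateness on the compact set {0} at order zero makes the values at the origin a generalized
   number. *)
have mc : moderate_num (fun e => u e 0).
  have /moderateE[_ /(_ [set 0] [ffun=> 0%N] (@compact_set1 _ _))] := mu.
  have -> : multi_seq [ffun=> 0%N] = [::] :> seq 'I_d.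
    by rewrite /multi_seq; elim: (enum _) => //= i l ->; rewrite ffunE.
  move=> [N [C _ [e0 e00 H]]]; exists N; exists C; exists e0 => // e ee0.
  rewrite lee_fin; apply: le_trans (H e ee0 0 erefl).
  by rewrite /cpart /cpartials /=; case: (u e 0).
exists (\pi_(gen_complex R) (@MkEMnum R _ (asboolT mc))).
rewrite pi_gconst fu; apply/pi_colombeau_eq => /=; apply/negligibleE.
have [su _] := mu.
split=> [e|K b cK].
  by apply: csmoothD => //; apply: csmoothN; exact: csmooth_cst.
have [r Kr] := compact_sub_cube R d K cK.
suff H : Neg (cube r) (cpart (multi_seq b) (fun e x => u e x - u e 0)).
  move=> m; have [C C0 [e0 e00 {}H]] := H m.
  by exists C => //; exists e0 => // e ee0 x Kx; apply: H => //; exact: Kr.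
(* At positive order the constant [u e 0] differentiates to 0, leaving the derivative of [u]
   alone. *)
have [b0|b0] := eqVneq (multi_seq b) [::].
  rewrite b0 (_ : cpart _ _ = fun e x => u e x - u e 0).
    exact: negligible_sub_origin.
  apply/funext => e; apply/funext => x; rewrite /cpart /cpartials /=.
  by case: (_ - _).
rewrite (_ : cpart _ _ = cpart (multi_seq b) u).
  exact: negligible_partials.
apply/funext => e; apply/funext => x; rewrite /cpart.
have cs : csmooth (cst (u e 0) : 'rV[R]_d -> R[i]) by exact: csmooth_cst.
rewrite (cpartialsD _ (su e) (csmoothN cs)) (cpartialsN _ cs) cpartials_cst.
by case: multi_seq b0 => // i s _; rewrite subr0.
Qed.
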